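(* The Geometric Consistency Index $GCI$ is strongly upper bounded: for all $m\ge 2$, all pairwise comparison matrices $\mathbf{A}_1,\ldots,\mathbf{A}_m\in\mathcal{A}$ of the same order and all $\boldsymbol{\lambda}\in\mathcal{L}_m$, $$GCI(\mathbf{A}^{\star})\le \sum_{h=1}^m\lambda_h\, GCI(\mathbf{A}_h).$$
   Context: A pairwise comparison matrix of order $n$ is a real $n\times n$ matrix $\mathbf{A}=(a_{ij})$ with $a_{ij}>0$ and $a_{ij}a_{ji}=1$ for all $i,j$. $\mathcal{A}$ is the set of all pairwise comparison matrices of all orders $n>2$. $\mathcal{L}_m=\{(\lambda_1,\ldots,\lambda_m): \lambda_h\ge 0\ \forall h,\ \sum_{h=1}^m\lambda_h=1\}$. Given $\mathbf{A}_h=(a_{ij}^{(h)})_{n\times n}\in\mathcal{A}$, $h=1,\ldots,m$ (same order $n$), and $\boldsymbol{\lambda}\in\mathcal{L}_m$, the aggregated matrix $\mathbf{A}^{\star}=(a_{ij}^{\star})_{n\times n}$ is $a_{ij}^{\star}=\prod_{h=1}^m (a_{ij}^{(h)})^{\lambda_h}$. For $\mathbf{A}\in\mathcal{A}$ of order $n$, $$GCI(\mathbf{A})=\frac{2}{(n-1)(n-2)}\sum_{i=1}^{n-1}\sum_{j=i+1}^{n}\left(\ln\left(a_{ij}\frac{\left(\prod_{k=1}^{n}a_{jk}\right)^{1/n}}{\left(\prod_{k=1}^{n}a_{ik}\right)^{1/n}}\right)\right)^2.$$ *)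

(* Defs.v *)
From mathcomp Require Import all_boot all_order all_algebra.
From mathcomp Require Import reals exp.

Set Implicit Arguments.
Unset Strict Implicit.
Unset Printing Implicit Defensive.

Import Order.TTheory GRing.Theory Num.Theory.
Local Open Scope ring_scope.

Section PairwiseComparison.
Variable R : realType.

Definition pairwise_comparison (n : nat) (A : 'M[R]_n) : Prop :=
  forall i j, 0 < A i j /\ A i j * A j i = 1.

Definition weights (m : nat) (lambda : 'I_m -> R) : Prop :=
  (forall h, 0 <= lambda h) /\ \sum_(h < m) lambda h = 1.

Definition aggregate (m n : nat) (lambda : 'I_m -> R) (A : 'I_m -> 'M[R]_n) :
    'M[R]_n :=
  \matrix_(i, j) \prod_(h < m) (A h i j `^ lambda h).

Definition row_gmean (n : nat) (A : 'M[R]_n) (i : 'I_n) : R :=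
  (\prod_(k < n) A i k) `^ (n%:R^-1).

Definition GCI (n : nat) (A : 'M[R]_n) : R :=
  2 / ((n%:R - 1) * (n%:R - 2)) *
  \sum_(i < n) \sum_(j < n | (i < j)%N)
    ln (A i j * (row_gmean A j / row_gmean A i)) ^+ 2.

(* An index is a real function of the pairwise comparison matrices of all
   orders n > 2; it is represented by a function on all square matrices, of
   which only the values at such matrices are constrained (the aggregated
   matrix is one of them, by [aggregate_pairwise_comparison]). *)
Definition strongly_upper_bounded (I : forall n, 'M[R]_n -> R) : Prop :=
  forall (m n : nat) (A : 'I_m -> 'M[R]_n) (lambda : 'I_m -> R),
    (2 <= m)%N -> (2 < n)%N ->
    (forall h, pairwise_comparison (A h)) ->
    weights lambda ->
    I n (aggregate lambda A) <= \sum_(h < m) lambda h * I n (A h).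

Lemma aggregate_pairwise_comparison (m n : nat) (A : 'I_m -> 'M[R]_n)
    (lambda : 'I_m -> R) :
  (forall h, pairwise_comparison (A h)) ->
  pairwise_comparison (aggregate lambda A).
Proof.
move=> pcA i j; rewrite !mxE; split.
  by apply: prodr_gt0 => h _; apply: powR_gt0; case: (pcA h i j).
rewrite -big_split big1//= => h _.
have [Aij_gt0 AijAji] := pcA h i j; have [Aji_gt0 _] := pcA h j i.
by rewrite -powRM ?ltW// AijAji powR1.
Qed.

End PairwiseComparison.

(* Main.v *)
(* The logarithm of each entry in the sum defining GCI is a linear function of
   the logarithms of the matrix entries, and the logarithm of the aggregated
   matrix is the convex combination of the logarithms. Hence GCI composed with
   exp is a nonnegative multiple of a sum of squares of linear forms, which is
   convex. *)
Require Import Defs.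
From mathcomp Require Import all_boot all_order all_algebra.
From mathcomp Require Import reals exp.
From mathcomp Require Import ring.

Set Implicit Arguments.
Unset Strict Implicit.
Unset Printing Implicit Defensive.

Import Order.TTheory GRing.Theory Num.Theory.
Local Open Scope ring_scope.

Lemma ln_prod (R : realType) (I : Type) (r : seq I) (F : I -> R) :
  (forall i, 0 < F i) -> ln (\prod_(i <- r) F i) = \sum_(i <- r) ln (F i).
Proof.
move=> F_gt0; elim: r => [|i r IHr]; first by rewrite !big_nil ln1.
by rewrite !big_cons lnM ?IHr// posrE ?prodr_gt0.
Qed.

(** The right side minus the left is the variance of [x] under the weights [lambda], a weighted sum
    of squares. *)
Lemma sqr_convex_sum (R : realType) (m : nat) (lambda x : 'I_m -> R) :
  weights lambda ->
  (\sum_(h < m) lambda h * x h) ^+ 2 <= \sum_(h < m) lambda h * x h ^+ 2.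
Proof.
move=> [lambda_ge0 sum_lambda]; set mu := \sum_(h < m) lambda h * x h.
have variance_ge0 : 0 <= \sum_(h < m) lambda h * (x h - mu) ^+ 2.
  by apply: sumr_ge0 => h _; rewrite mulr_ge0 ?sqr_ge0.
rewrite -subr_ge0; suff -> : \sum_(h < m) lambda h * x h ^+ 2 - mu ^+ 2 =
  \sum_(h < m) lambda h * (x h - mu) ^+ 2 by [].
(* The square is expanded with the factors constant in [h] on the right, so that they can be pulled
   out; the sums left over are [mu] and the total weight 1. *)
have -> : \sum_(h < m) lambda h * (x h - mu) ^+ 2 =
    \sum_(h < m) (lambda h * x h ^+ 2 + lambda h * x h * (- (2 * mu))
                  + lambda h * mu ^+ 2).
  by apply: eq_bigr => h _; ring.
by rewrite !big_split /= -!mulr_suml sum_lambda -/mu; ring.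
Qed.

Section LogarithmicForm.
Variables (R : realType) (n : nat).
Implicit Type A : 'M[R]_n.

(** Geometric row means become arithmetic means of logarithms, which makes the linearity in the
    [ln (A k l)] explicit. *)
Definition log_error A (i j : 'I_n) : R :=
  ln (A i j) + (n%:R^-1 * \sum_(k < n) ln (A j k)
                - n%:R^-1 * \sum_(k < n) ln (A i k)).

Lemma ln_errorE A (i j : 'I_n) : pairwise_comparison A ->
  ln (A i j * (row_gmean A j / row_gmean A i)) = log_error A i j.
Proof.
move=> pcA; have A_gt0 k l : 0 < A k l by case: (pcA k l).
have gmean_gt0 k : 0 < row_gmean A k by rewrite powR_gt0// prodr_gt0.
have ln_gmean k : ln (row_gmean A k) = n%:R^-1 * \sum_(l < n) ln (A k l).
  by rewrite ln_powR ln_prod.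
by rewrite lnM ?posrE ?divr_gt0// ln_div ?posrE// !ln_gmean.
Qed.

Lemma log_error_aggregate (m : nat) (A : 'I_m -> 'M[R]_n) (lambda : 'I_m -> R)
    (i j : 'I_n) : (forall h, pairwise_comparison (A h)) ->
  log_error (aggregate lambda A) i j =
  \sum_(h < m) lambda h * log_error (A h) i j.
Proof.
move=> pcA.
have ln_agg k l :
    ln (aggregate lambda A k l) = \sum_(h < m) lambda h * ln (A h k l).
  rewrite mxE ln_prod => [|h]; last by rewrite powR_gt0//; case: (pcA h k l).
  by apply: eq_bigr => h _; rewrite ln_powR.
have sum_ln_agg k : \sum_(l < n) ln (aggregate lambda A k l) =
    \sum_(h < m) lambda h * \sum_(l < n) ln (A h k l).
  under eq_bigr do rewrite ln_agg.
  by rewrite exchange_big /=; apply: eq_bigr => h _; rewrite mulr_sumr.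
rewrite /log_error ln_agg !sum_ln_agg !mulr_sumr -sumrB -big_split /=.
by apply: eq_bigr => h _; ring.
Qed.

End LogarithmicForm.

Theorem proposition3 (R : realType) : strongly_upper_bounded (@GCI R).
Proof.
move=> m n A lambda _ n_gt2 pcA wl.
set c : R := 2 / ((n%:R - 1) * (n%:R - 2)).
have c_ge0 : 0 <= c.
  (* Both factors of the denominator are nonnegative because [2 < n]. *)
  by rewrite divr_ge0// mulr_ge0// subr_ge0 ?ler1n ?ler_nat ltnW// ltnW.
have GCIE B : pairwise_comparison B ->
    GCI B = c * \sum_(i < n) \sum_(j < n | (i < j)%N) log_error B i j ^+ 2.
  move=> pcB; congr (_ * _); apply: eq_bigr => i _; apply: eq_bigr => j _.
  by rewrite ln_errorE.
rewrite GCIE; last exact: aggregate_pairwise_comparison.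
(* The common factor [c] is pulled out and dropped, and the sum over [h] is moved innermost, which
   leaves one convexity inequality for each pair [i < j]. *)
under [leRHS]eq_bigr do rewrite GCIE// mulrCA mulr_sumr.
rewrite -mulr_sumr ler_wpM2l// exchange_big /=; apply: ler_sum => i _.
under [leRHS]eq_bigr do rewrite mulr_sumr.
rewrite exchange_big /=; apply: ler_sum => j _.
by rewrite log_error_aggregate// sqr_convex_sum.
Qed.
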